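(* Let $\mathcal{P}$ be a local, probabilistic (bilateral) parking procedure, and $r\geq 1$. Then the sum of the parking probabilities $\mathrm{Park}_{\mathcal{P}}(W)$ over all words $W\in\mathbb{Z}^r$ of length $r$ is $(r+1)^{r-1}$.
   Context: $\mathrm{Fin}(\mathbb{Z})$ is the set of finite subsets of $\mathbb{Z}$; words have letters in $\mathbb{Z}$; $\epsilon$ is the empty word. A block of $S\subset\mathbb{Z}$ is a maximal nonempty interval of consecutive integers contained in $S$. A bilateral probabilistic parking procedure $\mathcal{P}$ is the data of real numbers $\mathrm{Dir}_{\mathcal{P}}(W,S,a)\in[0,1]$ (the probability to go right) for all $S\in\mathrm{Fin}(\mathbb{Z})$, all words $W$ with exactly $\#S$ letters all of which belong to $S$, and all $a\in S$. Let $G(\mathcal{P})$ be the weighted directed graph whose vertices are all such pairs $(W,S)$, with the following edges for each vertex $(W,S)$ and each $a\in\mathbb{Z}$: if $a\notin S$, an edge $(W,S)\to(Wa,S\sqcup\{a\})$ of weight $1$; if $a\in S$ and $\{s,\ldots,t\}$ is the block of $S$ containing $a$, an edge $(W,S)\to(Wa,S\cup\{t+1\})$ of weight $\mathrm{Dir}_{\mathcal{P}}(W,S,a)$ and an edge $(W,S)\to(Wa,S\cup\{s-1\})$ of weight $1-\mathrm{Dir}_{\mathcal{P}}(W,S,a)$. Then $\mathcal{P}_W(S)$ is the total weight (sum over paths of the product of edge weights) of all paths from $(\epsilon,\emptyset)$ to $(W,S)$ (it is $0$ if $(W,S)$ is not a vertex). For fixed $W$, $\mathcal{P}_W$ is a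 finitely supported probability measure on $\mathrm{Fin}(\mathbb{Z})$. The parking probability of a word $W$ of length $r$ is $\mathrm{Park}_{\mathcal{P}}(W)=\mathcal{P}_W(\{1,\ldots,r\})$. Let $\tau:i\mapsto i+1$ on $\mathbb{Z}$, extended to subsets and words. $\mathcal{P}$ is local if it is shift invariant, i.e. $\mathrm{Dir}_{\mathcal{P}}(\tau(W),\tau(S),\tau(a))=\mathrm{Dir}_{\mathcal{P}}(W,S,a)$ for all $(W,S,a)$, and locally decided, i.e. whenever $\mathcal{P}_W(S)>0$, $a\in S$, and $I$ is the block of $S$ containing $a$, one has $\mathrm{Dir}_{\mathcal{P}}(W,S,a)=\mathrm{Dir}_{\mathcal{P}}(W_{|I},I,a)$, where $W_{|I}$ is the subword of $W$ formed by the letters of the cars that parked in $I$ (equivalently, since the procedure is bilateral, by the letters of $W$ belonging to $I$; it has exactly $\#I$ letters). *)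

(* Defs.v *)
From HB Require Import structures.
From mathcomp Require Import all_boot all_order all_algebra finmap.
From mathcomp Require Import boolp classical_sets fsbigop reals ereal esum.

Set Implicit Arguments.
Unset Strict Implicit.
Unset Printing Implicit Defensive.

Import Order.TTheory GRing.Theory Num.Theory.

Local Open Scope ring_scope.
Local Open Scope classical_set_scope.

Definition word := seq int.

Definition state : Type := (word * {fset int})%type.

Definition is_vertex (v : state) : Prop :=
  #|` v.2| = size v.1 /\ (forall x, x \in v.1 -> x \in v.2).

(* {s, ..., t} is a block of S. *)
Definition is_block (S : {fset int}) (s t : int) : Prop :=
  let included s' t' := forall x : int, s' <= x <= t' -> x \in S in
  [/\ s <= t, included s t
    & forall s' t' : int, s' <= s -> t <= t' -> included s' t' ->
        s' = s /\ t' = t].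

(* [Dir] is total, but its values are constrained, and used below, only at
   triples (W, S, a) such that (W, S) is a vertex and a \in S. *)
Record bilateral_procedure (R : realType) := BilateralProcedure {
  Dir : word -> {fset int} -> int -> R;
  Dir_itv : forall (W : word) (S : {fset int}) (a : int),
    is_vertex (W, S) -> a \in S -> 0 <= Dir W S a <= 1 }.

(* [edge P u v w]: the graph G(P) has an edge u -> v of weight w.  There are no
   parallel edges: a is the last letter of the word of the target, and the two
   edges available when a \in S have different targets. *)
Inductive edge (R : realType) (P : bilateral_procedure R) :
    state -> state -> R -> Prop :=
| edge_free W S (a : int) : is_vertex (W, S) -> a \notin S ->
    edge P (W, S) (rcons W a, (a |` S)%fset) 1
| edge_right W S (a s t : int) : is_vertex (W, S) -> is_block S s t ->
    s <= a <= t ->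
    edge P (W, S) (rcons W a, ((t + 1)%R |` S)%fset) (Dir P W S a)
| edge_left W S (a s t : int) : is_vertex (W, S) -> is_block S s t ->
    s <= a <= t ->
    edge P (W, S) (rcons W a, ((s - 1)%R |` S)%fset) (1 - Dir P W S a).

(* A path starting at u is encoded by the list of the targets of its edges,
   each paired with the weight of the edge. *)
Fixpoint is_path (R : realType) (P : bilateral_procedure R)
    (u : state) (p : seq (state * R)) (v : state) : Prop :=
  if p is e :: p' then edge P u e.1 e.2 /\ is_path P e.1 p' v else u = v.

Definition path_weight (R : realType) (p : seq (state * R)) : R :=
  \prod_(e <- p) e.2.

(* There are only finitely many paths between two vertices, so that the
   finitely supported sum is the actual sum over all paths. *)
Definition prob (R : realType) (P : bilateral_procedure R)
    (W : word) (S : {fset int}) : R :=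
  \sum_(p \in [set p : seq (state * R) | is_path P ([::], fset0) p (W, S)])
    path_weight p.

Definition park (R : realType) (P : bilateral_procedure R) (W : word) : R :=
  prob P W [fset Posz i | i in iota 1 (size W)]%fset.

Definition shift_word (W : word) : word := [seq x + 1 | x <- W].

Definition shift_fset (S : {fset int}) : {fset int} :=
  [fset (x + 1)%R | x in S]%fset.

Definition shift_invariant (R : realType) (P : bilateral_procedure R) : Prop :=
  forall (W : word) (S : {fset int}) (a : int), is_vertex (W, S) -> a \in S ->
    Dir P (shift_word W) (shift_fset S) (a + 1) = Dir P W S a.

Definition locally_decided (R : realType) (P : bilateral_procedure R) : Prop :=
  forall (W : word) (S : {fset int}) (a s t : int),
    0 < prob P W S -> is_block S s t -> s <= a <= t ->
    let I := [fset x in S | (s <= x <= t)%R]%fset in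
    Dir P W S a = Dir P [seq x <- W | x \in I] I a.

Definition is_local (R : realType) (P : bilateral_procedure R) : Prop :=
  shift_invariant P /\ locally_decided P.

(* Main.v *)
(** Write [a n] for the sum of the parking probabilities of the words of length
    [n], and [b n] for the same sum in which each word is weighted by the sum of
    its probabilities to go right over the preferences of a further car.  The
    last of [n + 1] cars parks in the only free spot [j = k + 1] of
    [{1, ..., n + 1}].  By locality, the cars to the left and to the right of [j]
    park independently, and the last car reaches [j] if it prefers [j], if it
    prefers one of the [k] spots to the left and goes right, or if it prefers one
    of the [l = n - k] spots to the right and goes left.  Hence
      [a (n + 1) = \sum_k 'C(n, k) (a k * a l * (l + 1) + b k * a l - a k * b l)],
    where the terms containing [b] cancel by the symmetry [k <-> l]; Abel's
    binomial identity solves the remaining recursion. *)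
Require Import Defs.
From mathcomp Require Import all_boot all_order all_algebra finmap.
From mathcomp Require Import boolp classical_sets fsbigop reals ereal esum.
From mathcomp Require Import cardinality zify ring.

Set Implicit Arguments.
Unset Strict Implicit.
Unset Printing Implicit Defensive.

Import Order.TTheory GRing.Theory Num.Theory.

Local Open Scope ring_scope.
Local Open Scope classical_set_scope.

(** * Edges described by the preference and the spot taken *)

Definition reach (S : {fset int}) (a j : int) : bool :=
  `[< forall z : int, z != j -> (a <= z <= j) || (j <= z <= a) -> z \in S >].

Definition hop (R : realType) (P : bilateral_procedure R) (W : word)
    (S : {fset int}) (a j : int) : R :=
  if a == j then 1 else if a < j then Dir P W S a else 1 - Dir P W S a.

Lemma fset_exit (S : {fset int}) (f : nat -> int) : injective f ->
  exists n, f n \notin S.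
Proof.
move=> finj; apply: contrapT => /forallNP fS.
have sub : {subset [seq f i | i <- iota 0 #|` S|.+1] <= enum_fset S}.
  move=> _ /mapP[i _ ->]; exact/negPn/negP/fS.
have := uniq_leq_size _ sub; rewrite map_inj_uniq ?iota_uniq // => /(_ isT).
by rewrite size_map size_iota cardfE -cardfE ltnn.
Qed.

(** Walking right and left from [a], one leaves the finite set [S]; the ends of the block come just
    before the first spots outside [S]. *)
Lemma block_exists (S : {fset int}) (a : int) : a \in S ->
  exists s t, is_block S s t /\ s <= a <= t.
Proof.
move=> aS.
have iP : injective (fun n : nat => a + n%:Z) by move=> x y /=; lia.
have iN : injective (fun n : nat => a - n%:Z) by move=> x y /=; lia.
have := fset_exit S iP; case/ex_minnP => m mS mmin.
have := fset_exit S iN; case/ex_minnP => n nS nmin.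
have m0 : (0 < m)%N by case: m mS {mmin} => //=; rewrite addr0 aS.
have n0 : (0 < n)%N by case: n nS {nmin} => //=; rewrite subr0 aS.
have inS z : a - n%:Z < z < a + m%:Z -> z \in S.
  move=> /andP[lz zm]; apply: contraT => zS.
  have [az|za] := leP a z.
    have := mmin (absz (z - a)).
    have -> : a + `|z - a|%N%:Z = z by lia.
    move=> /(_ zS); lia.
  have := nmin (absz (z - a)).
  have -> : a - `|z - a|%N%:Z = z by lia.
  move=> /(_ zS); lia.
exists (a - n%:Z + 1), (a + m%:Z - 1); split; last by lia.
split; first by lia.
  by move=> x xst; apply: inS; lia.
move=> s' t' ss' tt' inc; split.
  apply/eqP; apply: contraNT nS => ne; apply: inc; lia.
apply/eqP; apply: contraNT mS => ne; apply: inc; lia.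
Qed.

(** A free spot reachable from [a] is either [a] itself or adjacent to the block of [a], and its
    side tells the direction taken. The pair ([a], [j]) thus covers the three constructors of [edge]
    at once, without mention of block ends. *)
Lemma edgeP (R : realType) (P : bilateral_procedure R) W S v (x : R) :
  edge P (W, S) v x <->
  exists a j, [/\ is_vertex (W, S), j \notin S, reach S a j,
                  v = (rcons W a, j |` S)%fset & x = hop P W S a j].
Proof.
split.
- move E : (W, S) => u H; case: H E => [W' S' a|W' S' a s t|W' S' a s t] V.
  + move=> aS [-> ->]; exists a, a; split => //.
      by apply/asboolP => z zj; rewrite orbb => /le_anti za; rewrite za eqxx in zj.
    by rewrite /hop eqxx.
  + move=> [st inc mx] ast [-> ->]; exists a, (t + 1).
    split => //.
    * apply/negP => tS; have [] := mx s (t + 1); rewrite ?lexx//; try lia.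
      move=> z zst; have [->//|zt] := eqVneq z (t + 1); apply: inc; lia.
    * by apply/asboolP => z zt zst; apply: inc; lia.
    * by rewrite /hop; case: eqP => [|_]; [lia|case: ltP => //; lia].
  + move=> [st inc mx] ast [-> ->]; exists a, (s - 1).
    split => //.
    * apply/negP => tS; have [] := mx (s - 1) t; rewrite ?lexx//; try lia.
      move=> z zst; have [->//|zt] := eqVneq z (s - 1); apply: inc; lia.
    * by apply/asboolP => z zt zst; apply: inc; lia.
    * by rewrite /hop; case: eqP => [|_]; [lia|case: ltP => //; lia].
- move=> [a [j [V jS /asboolP rj -> ->]]]; rewrite /hop.
  have [aj|aj] := eqVneq a j.
    rewrite -aj in jS *; exact: edge_free.
  have aS : a \in S by apply: rj => //; lia.
  have [s [t [bl ast]]] := block_exists aS.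
  have [st inc mx] := bl.
  have [alj|jla] := ltP a j.
    (* The free spot [j] lies beyond the block. If it were not adjacent, [t + 1] would be occupied,
       against the maximality of the block. *)
    have -> : j = t + 1.
      have : ~ (j <= t) by move=> jt; move: jS; rewrite inc //; lia.
      have : ~ (t + 1 < j).
        move=> tj; have [] := mx s (t + 1); rewrite ?lexx //; try lia.
        move=> z zst; have [->|zt] := eqVneq z (t + 1); [apply: rj|apply: inc]; lia.
      lia.
    exact: edge_right bl ast.
  have -> : j = s - 1.
    have : ~ (s <= j) by move=> jt; move: jS; rewrite inc //; lia.
    have : ~ (j < s - 1).
      move=> tj; have [] := mx (s - 1) t; rewrite ?lexx //; try lia.
      move=> z zst; have [->|zt] := eqVneq z (s - 1); [apply: rj|apply: inc]; lia.
    lia.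
  exact: edge_left bl ast.
Qed.

(** * Paths from the empty state, and the recursion on the last car *)

Lemma is_path_rcons (R : realType) (P : bilateral_procedure R) u p e v :
  is_path P u (rcons p e) v <->
  exists u', [/\ is_path P u p u', edge P u' e.1 e.2 & e.1 = v].
Proof.
elim: p u => [|d p IHp] u /=.
  split=> [[eu ev]|[u' [-> eu ev]] //]; by exists u.
split=> [[du /IHp[u' [pu eu ev]]]|[u' [[du pu] eu ev]]]; first by exists u'.
by split=> //; apply/IHp; exists u'.
Qed.

Lemma is_path_end (R : realType) (P : bilateral_procedure R) u p v w :
  is_path P u p v -> is_path P u p w -> v = w.
Proof. by elim: p u => [|e p IHp] u /=; [move=> <- <-|move=> [_ +] [_]; apply: IHp]. Qed.

Lemma is_path_vertex (R : realType) (P : bilateral_procedure R) p v :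
  is_path P ([::], fset0) p v -> is_vertex v.
Proof.
case/lastP: p => [<-|p [v' x]]; first by split; rewrite ?cardfs0.
case/is_path_rcons=> -[W S] [_ /edgeP[a [j [[/= VS VW] jS raj /= -> _]]] <-].
split=> /= [|y]; first by rewrite cardfsU1 jS VS size_rcons.
rewrite mem_rcons in_cons in_fset1U => /predU1P[->|/VW ->]; last by rewrite orbT.
have [//|aj /=] := eqVneq a j.
by move/asboolP: raj; apply => //; have := le_total a j; lia.
Qed.

(* Words are read from the last letter, so [paths] recurses on the reversed
   word. *)
Fixpoint paths (R : realType) (P : bilateral_procedure R) (rW : word)
    (S : {fset int}) : seq (seq (state * R)) :=
  if rW is a :: rW' then
    [seq rcons p ((rev rW, S), hop P (rev rW') (S `\ j)%fset a j)
      | j <- [seq j <- enum_fset S | reach (S `\ j)%fset a j],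
        p <- paths P rW' (S `\ j)%fset]
  else if S == fset0 then [:: [::]] else [::].

Lemma mem_paths (R : realType) (P : bilateral_procedure R) rW S p :
  p \in paths P rW S <-> is_path P ([::], fset0) p (rev rW, S).
Proof.
elim: rW S p => [|a rW IH] S p /=.
  have [->|S0] := eqVneq S fset0.
    split; first by rewrite inE => /eqP ->.
    case/lastP: p => [//|p [v x]] /is_path_rcons[[W T] [_ /edgeP[b [j [_ _ _ -> _]]]]].
    by case=> /(congr1 size); rewrite size_rcons.
  split=> //; case/lastP: p => [[]/esym/eqP|p [v x]]; first by rewrite (negbTE S0).
  case/is_path_rcons=> -[W T] [_ /edgeP[b [j [_ _ _ -> _]]]].
  by case=> /(congr1 size); rewrite size_rcons.
rewrite rev_cons; split.
  case/allpairsPdep => j [q [+ /IH qP ->]].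
  rewrite mem_filter => /andP[rj jS]; apply/is_path_rcons.
  exists (rev rW, (S `\ j)%fset); split=> //=; apply/edgeP; exists a, j.
  split=> //; first exact: is_path_vertex qP.
    by rewrite !inE eqxx.
  by rewrite fsetD1K.
case/lastP: p => [[] /(congr1 size)|p [v x]]; first by rewrite size_rcons.
case/is_path_rcons=> -[W T] [pP /edgeP[b [j [V jS rj /= vE xE]]]] vS.
move: vS; rewrite vE => -[/rcons_inj[WE bE] SE]; subst W b x.
have TE : T = (S `\ j)%fset by rewrite -SE fsetU1K.
subst T; apply/allpairsPdep; exists j, p; split.
- by rewrite mem_filter rj -SE !inE eqxx.
- exact/IH.
- by rewrite SE.
Qed.

Lemma uniq_paths (R : realType) (P : bilateral_procedure R) rW S :
  uniq (paths P rW S).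
Proof.
elim: rW S => [|a rW IH] S /=; first by case: eqP.
apply: allpairs_uniq_dep => //; first by rewrite filter_uniq ?fset_uniq.
move=> _ _ /allpairsPdep[j [p [+ pP ->]]] /allpairsPdep[k [q [+ qP ->]]] /=.
rewrite !mem_filter => /andP[_ jS] /andP[_ kS] /rcons_inj[pq _].
subst q; move: pP qP => /mem_paths pP /mem_paths qP.
(* The common prefix has a single end, so the two sets left after removing the last spot agree,
   which forces [j = k]. *)
have [/fsetP/(_ j)] := is_path_end pP qP.
by rewrite !inE eqxx jS andbT /=; case: eqP => // ->.
Qed.

Lemma prob_paths (R : realType) (P : bilateral_procedure R) W S :
  prob P W S = \sum_(p <- paths P (rev W) S) path_weight p.
Proof.
rewrite /prob (_ : [set p | _] = [set` paths P (rev W) S]).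
  by rewrite -fsbig_seq ?uniq_paths.
by apply/seteqP; split=> p /=; rewrite mem_paths revK.
Qed.

Lemma prob_nil (R : realType) (P : bilateral_procedure R) S :
  prob P [::] S = (S == fset0)%:R.
Proof.
by rewrite prob_paths /=; case: eqP; rewrite ?big_seq1 ?big_nil // /path_weight big_nil.
Qed.

(** The last edge of a path to [S] fills some spot [j] of [S]; what precedes it is a path to [S]
    without [j]. *)
Lemma prob_rcons (R : realType) (P : bilateral_procedure R) W a S :
  prob P (rcons W a) S =
  \sum_(j <- enum_fset S | reach (S `\ j)%fset a j)
     prob P W (S `\ j)%fset * hop P W (S `\ j)%fset a j.
Proof.
rewrite prob_paths rev_rcons /= big_allpairs_dep big_filter revK.
apply: eq_bigr => j _; rewrite prob_paths big_distrl /=.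
by apply: eq_bigr => p _; rewrite /path_weight big_rcons.
Qed.

Lemma prob_vertex (R : realType) (P : bilateral_procedure R) W S :
  prob P W S != 0 -> is_vertex (W, S).
Proof.
rewrite prob_paths; case: (paths _ _ _) (@mem_paths _ P (rev W) S) => [|p s] pP.
  by rewrite big_nil eqxx.
by have /pP := mem_head p s; rewrite revK => /is_path_vertex.
Qed.

Lemma reach_neq S a j : reach S a j -> a != j -> a \in S.
Proof. by move=> /asboolP rj aj; apply: rj => //; have := le_total a j; lia. Qed.

Lemma hop_ge0 (R : realType) (P : bilateral_procedure R) W S a j :
  is_vertex (W, S) -> reach S a j -> 0 <= hop P W S a j.
Proof.
move=> V rj; rewrite /hop; case: eqVneq => // /(reach_neq rj) aS.
by have /andP[D0 D1] := Dir_itv P V aS; case: ifP; rewrite ?subr_ge0.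
Qed.

Lemma prob_ge0 (R : realType) (P : bilateral_procedure R) W S :
  0 <= prob P W S.
Proof.
elim/last_ind: W S => [|W a IH] S; first by rewrite prob_nil ler0n.
rewrite prob_rcons; apply: sumr_ge0 => j rj.
(* [Dir] is bounded only at vertices, and a nonzero probability guarantees a vertex. *)
have [->|/prob_vertex V] := eqVneq (prob P W (S `\ j)%fset) 0; first by rewrite mul0r.
by rewrite mulr_ge0 // hop_ge0.
Qed.

(** * Local decision and independence of separated regions *)

Lemma perm_fset_filter (S : {fset int}) (p : pred int) :
  perm_eq (enum_fset [fset x in S | p x]%fset) [seq x <- enum_fset S | p x].
Proof.
apply: uniq_perm; rewrite ?filter_uniq ?fset_uniq // => x.
by rewrite mem_filter !inE andbC.
Qed.

Lemma fset_filterD1 (S : {fset int}) (p : pred int) j :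
  ([fset x in S | p x] `\ j)%fset = [fset x in (S `\ j)%fset | p x]%fset.
Proof. by apply/fsetP => x; rewrite !inE andbA. Qed.

(** This makes the part of [S] where [p] holds a union of blocks of [S], in a form that passes to
    subsets of [S]. *)
Definition separated (p : pred int) (S : {fset int}) :=
  forall x : int, x \in S -> x + 1 \in S -> p x = p (x + 1).

Lemma separatedC p S : separated p S -> separated (predC p) S.
Proof. by move=> sp x xS x1S /=; rewrite (sp x). Qed.

Lemma separatedS p (S T : {fset int}) :
  {subset T <= S} -> separated p S -> separated p T.
Proof. by move=> sub sp x /sub xS /sub x1S; apply: sp. Qed.

Lemma separated_gap (S : {fset int}) (j : int) : j \notin S ->
  separated (fun x => x < j) S.
Proof.
move=> jS x xS x1S; have : x <> j by move=> xj; rewrite -xj xS in jS.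
have : x + 1 <> j by move=> xj; rewrite -xj x1S in jS.
by lia.
Qed.

Lemma separated_itv p S x y : separated p S -> x <= y ->
  (forall z : int, x <= z <= y -> z \in S) ->
  forall z, x <= z <= y -> p z = p x.
Proof.
move=> sp xy inS z /andP[xz zy].
have -> : z = x + `|z - x|%N%:Z by lia.
have : `|z - x|%N%:Z <= y - x by lia.
elim: `|z - x|%N => [|n IHn] ny; first by rewrite addr0.
rewrite -IHn; last by lia.
have -> : x + n.+1%:Z = x + n%:Z + 1 by lia.
by rewrite -sp //; apply: inS; lia.
Qed.

Lemma reach_itv S a j z : reach (S `\ j)%fset a j -> j \in S ->
  (a <= z <= j) || (j <= z <= a) -> z \in S.
Proof.
move=> /asboolP rj jS zaj; have [->//|zj] := eqVneq z j.
by have := rj z zj zaj; rewrite !inE => /andP[].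
Qed.

(** All spots between [a] and [j], both included, lie in [S], so [p] cannot change along the way of
    the car. *)
Lemma reach_separated p S a j z : separated p S -> j \in S ->
  reach (S `\ j)%fset a j -> (a <= z <= j) || (j <= z <= a) -> p z = p a.
Proof.
move=> sp jS rj zaj; have [aj|ja] := leP a j.
  by apply: (separated_itv sp aj); [move=> y ?; apply: (reach_itv rj)|]; lia.
have inS y : j <= y <= a -> y \in S by move=> ?; apply: (reach_itv rj) => //; lia.
have jla := ltW ja.
by rewrite (separated_itv sp jla inS) -1?(separated_itv sp jla inS (z := a)) //; lia.
Qed.

Lemma reach_filter p S a j : separated p S -> j \in S -> p a ->
  reach (S `\ j)%fset a j =
  p j && reach ([fset x in S | p x] `\ j)%fset a j.
Proof.
move=> sp jS pa; apply/idP/andP => [rj|[pj /asboolP rj]].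
  split; first by rewrite (reach_separated sp jS rj) //; have := le_total a j; lia.
  apply/asboolP => z zj zaj; have pz := reach_separated sp jS rj zaj.
  by rewrite !inE zj pz pa (reach_itv rj jS zaj).
apply/asboolP => z zj zaj; have := rj z zj zaj.
by rewrite !inE => /andP[-> /andP[-> _]].
Qed.

(** Since [p] is constant on the block of [a], this block is also a block of the part of [S] where
    [p] holds, and local decision reduces both sides to the same data. Positivity is assumed twice
    because [locally_decided] speaks only of states of positive probability. *)
Lemma Dir_filter (R : realType) (P : bilateral_procedure R) p W S a :
  locally_decided P -> separated p S -> a \in S -> p a ->
  0 < prob P W S -> 0 < prob P [seq x <- W | p x] [fset x in S | p x]%fset ->
  Dir P W S a = Dir P [seq x <- W | p x] [fset x in S | p x]%fset a.
Proof.
move=> loc sp aS pa W0 pW0.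
have [s [t [bl ast]]] := block_exists aS.
have [st inc mx] := bl.
have pst z : s <= z <= t -> p z.
  move=> zst; rewrite (separated_itv sp st inc zst).
  by rewrite -(separated_itv sp st inc ast).
have bl' : is_block [fset x in S | p x]%fset s t.
  split=> //; first by move=> z zst; rewrite !inE inc // pst.
  by move=> s' t' ss tt inc'; apply: mx => // z /inc'; rewrite !inE => /andP[].
rewrite (loc _ _ _ _ _ W0 bl ast) (loc _ _ _ _ _ pW0 bl' ast).
have <- : [fset x in S | s <= x <= t]%fset =
          [fset x in [fset x in S | p x] | s <= x <= t]%fset.
  apply/fsetP => x; rewrite !inE -andbA; case: (x \in S) => //=.
  by case E: (s <= x <= t); rewrite ?andbF // pst.
rewrite -filter_predI; congr (Dir P _ _ a); apply: eq_filter => x /=.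
by rewrite !inE; case E: (s <= x <= t); rewrite ?andbF // pst // !andbT.
Qed.

Lemma hop_filter (R : realType) (P : bilateral_procedure R) p W S a j :
  locally_decided P -> separated p S -> reach S a j -> p a ->
  0 < prob P W S -> 0 < prob P [seq x <- W | p x] [fset x in S | p x]%fset ->
  hop P W S a j = hop P [seq x <- W | p x] [fset x in S | p x]%fset a j.
Proof.
move=> loc sp rj pa W0 pW0; rewrite /hop; case: eqVneq => // /(reach_neq rj) aS.
by rewrite (Dir_filter loc sp aS pa W0 pW0).
Qed.

(* A car preferring a spot of [p] interacts only with cars of [p], so that the
   parkings inside and outside [p] are independent. *)
Lemma prob_separated (R : realType) (P : bilateral_procedure R) p W S :
  locally_decided P -> separated p S ->
  prob P W S = prob P [seq x <- W | p x] [fset x in S | p x]%fset *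
               prob P [seq x <- W | predC p x] [fset x in S | predC p x]%fset.
Proof.
move=> loc; elim/last_ind: W p S => [|W a IH] p S sp.
  rewrite !prob_nil -natrM mulnb; congr (nat_of_bool _)%:R.
  apply/eqP/andP => [->|[/eqP p0 /eqP q0]].
    by split; apply/eqP/fsetP => x; rewrite !inE.
  apply/fsetP => x; have := congr1 (fun A => x \in A) p0.
  have := congr1 (fun A => x \in A) q0; rewrite !inE /=.
  by case: (x \in S) (p x) => [] [].
(* The statement is symmetric in [p] and its complement, so the last car may be taken to prefer a
   spot of [p]. *)
wlog pa : p sp / p a => [wl|].
  have [/wl|npa] := boolP (p a); first exact.
  rewrite (wl _ (separatedC sp) npa) mulrC.
  have pp : predC (predC p) =1 p by move=> x /=; rewrite negbK.
  rewrite (eq_filter pp); congr (prob P _ _ * _).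
  by apply/fsetP => x; rewrite !inE /= negbK.
rewrite !filter_rcons /= pa /= !prob_rcons big_distrl /=.
rewrite [RHS](perm_big _ (perm_fset_filter S p)).
rewrite big_filter_cond [LHS]big_seq_cond [RHS]big_seq_cond.
apply: eq_big => [j|j /andP[jS rj]].
  by apply: andb_id2l => jS; rewrite (reach_filter sp jS).
have spj : separated p (S `\ j)%fset.
  by apply: separatedS sp => x; rewrite !inE => /andP[].
have pj : p j by move: rj; rewrite (reach_filter sp) // => /andP[].
(* The last car parks inside [p], so removing its spot leaves the other region unchanged. *)
have qE : [fset x in S | ~~ p x]%fset = [fset x in (S `\ j)%fset | predC p x]%fset.
  apply/fsetP => x; rewrite !inE /=.
  by have [->|] := eqVneq x j; rewrite ?pj ?andbF.
rewrite fset_filterD1 qE mulrAC -IH //.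
(* Local decision is silent on states of probability zero, but there both sides vanish. Otherwise
   the induction hypothesis makes the factor inside [p] nonzero too. *)
have [->|W0] := eqVneq (prob P W (S `\ j)%fset) 0; first by rewrite !mul0r.
have gt0 : forall W S, prob P W S != 0 -> 0 < prob P W S.
  by move=> V T; rewrite lt_neqAle eq_sym prob_ge0 => ->.
congr (_ * _); apply: hop_filter => //; apply: gt0 => //.
by apply: contra_neq W0 => W0; rewrite (IH p) // W0 mul0r.
Qed.

(** * Invariance under translation *)

Definition translate_fset (c : int) (S : {fset int}) : {fset int} :=
  [fset (x + c)%R | x in S]%fset.

Lemma mem_translate c S x : (x + c \in translate_fset c S) = (x \in S).
Proof. exact: (mem_imfset _ _ (addIr c)). Qed.

Lemma mem_translateB c S x : (x \in translate_fset c S) = (x - c \in S).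
Proof. by rewrite -(mem_translate c) subrK. Qed.

Lemma translate_fset0 S : translate_fset 0 S = S.
Proof. by apply/fsetP => x; rewrite mem_translateB subr0. Qed.

Lemma translate_fsetD c d S :
  translate_fset c (translate_fset d S) = translate_fset (d + c) S.
Proof. by apply/fsetP => x; rewrite !mem_translateB addrAC -addrA -opprD addrC. Qed.

Lemma card_translate c S : #|` translate_fset c S| = #|` S|.
Proof. by rewrite card_imfset //; apply: addIr. Qed.

Lemma perm_translate c S :
  perm_eq (enum_fset (translate_fset c S)) [seq x + c | x <- enum_fset S].
Proof.
apply: uniq_perm; rewrite ?map_inj_uniq ?fset_uniq //; first exact: addIr.
by move=> x; rewrite (mem_translateB c) -[x in RHS](subrK c) (mem_map (addIr c)).
Qed.

Lemma vertex_translate c W S : is_vertex (W, S) ->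
  is_vertex ([seq x + c | x <- W], translate_fset c S).
Proof.
move=> [/= VS VW]; split; first by rewrite card_translate size_map.
by move=> _ /mapP[x /VW xS ->]; rewrite mem_translate.
Qed.

Lemma Dir_translate (R : realType) (P : bilateral_procedure R) W S a (n : nat) :
  shift_invariant P -> is_vertex (W, S) -> a \in S ->
  Dir P [seq x + n%:Z | x <- W] (translate_fset n%:Z S) (a + n%:Z) = Dir P W S a.
Proof.
move=> inv V aS; elim: n => [|n <-].
  by rewrite translate_fset0 addr0 map_id_in // => x _; rewrite addr0.
rewrite -[RHS]inv ?mem_translate //; last exact: vertex_translate.
congr (Dir P _ _ _); last by lia.
  by rewrite /shift_word -map_comp; apply: eq_map => x /=; lia.
by rewrite [shift_fset _]translate_fsetD; congr translate_fset; lia.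
Qed.

(** Translations by natural numbers iterate the unit shift; they carry an initial interval to the
    spots on the right of a gap. *)
Lemma prob_translate (R : realType) (P : bilateral_procedure R) W S (n : nat) :
  shift_invariant P ->
  prob P [seq x + n%:Z | x <- W] (translate_fset n%:Z S) = prob P W S.
Proof.
move=> inv; elim/last_ind: W S => [|W a IH] S.
  by rewrite !prob_nil -!cardfs_eq0 card_translate.
rewrite map_rcons !prob_rcons.
rewrite (perm_big _ (perm_translate n%:Z S)).
have SjE (j : int) : (translate_fset n%:Z S `\ (j + n%:Z)%R)%fset = translate_fset n%:Z (S `\ j)%fset.
  by apply/fsetP => x; rewrite !(inE, mem_translateB) subr_eq.
rewrite big_map; apply: eq_big => [j|j rj].
  rewrite SjE; apply/asboolP/asboolP => H z zj zaj.
    by rewrite -(mem_translate n%:Z); apply: H; lia.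
  by rewrite mem_translateB; apply: H; lia.
rewrite SjE IH.
have [->|/prob_vertex V] := eqVneq (prob P W (S `\ j)%fset) 0; first by rewrite !mul0r.
congr (_ * _); rewrite /hop (inj_eq (addIr _)) ltrD2r.
have rj' : reach (S `\ j)%fset a j.
  apply/asboolP => z zj zaj; rewrite -(mem_translate n%:Z) -SjE.
  by move/asboolP: rj; apply; lia.
by case: eqVneq => // /(reach_neq rj') aS; rewrite Dir_translate.
Qed.

(** * Sums over the words on a finite alphabet *)

Section Words.
Variables (T : eqType) (R : comPzRingType).
Implicit Types (s : seq T) (F : seq T -> R).

Fixpoint words_over s (n : nat) : seq (seq T) :=
  if n is n'.+1 then [seq rcons W a | a <- s, W <- words_over s n'] else [:: [::]].

Lemma mem_words_over s n W :
  (W \in words_over s n) = (size W == n) && all (mem s) W.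
Proof.
elim: n W => [|n IHn] W /=; first by rewrite inE; case: W.
apply/allpairsP/idP => [[[a V] [/= sa + ->]]|].
  by rewrite IHn size_rcons eqSS all_rcons /= sa.
case/lastP: W => [//|V a]; rewrite size_rcons eqSS all_rcons /=.
by case/and3P=> nV sa sV; exists (a, V); rewrite IHn nV.
Qed.

Lemma uniq_words_over s n : uniq s -> uniq (words_over s n).
Proof.
move=> us; elim: n => //= n IHn; apply: allpairs_uniq => //.
by move=> [a V] [b W] _ _ /= /rcons_inj[-> ->].
Qed.

Lemma sum_words_recr s n F :
  \sum_(W <- words_over s n.+1) F W =
  \sum_(a <- s) \sum_(W <- words_over s n) F (rcons W a).
Proof. by rewrite big_allpairs_dep. Qed.

Lemma sum_words_support s s' n F : uniq s -> uniq s' -> {subset s' <= s} ->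
  (forall W, size W = n -> F W != 0 -> {subset W <= s'}) ->
  \sum_(W <- words_over s n) F W = \sum_(W <- words_over s' n) F W.
Proof.
move=> us us' sub supp.
rewrite (bigID (all (mem s'))) /= [X in _ + X]big1_seq ?addr0; last first.
  move=> W /andP[/allPn[a aW as'] +]; rewrite mem_words_over => /andP[/eqP nW _].
  by apply: contraNeq as' => F0; apply: (supp W).
rewrite -big_filter; apply: perm_big; apply: uniq_perm.
- exact/filter_uniq/uniq_words_over.
- exact: uniq_words_over.
move=> W; rewrite mem_filter !mem_words_over; case: eqP => //=; rewrite ?andbF // => _.
by case: (boolP (all (mem s') W)) => //= /allP ss; apply/allP => x /ss/sub.
Qed.

(* There are ['C(n, k)] ways to shuffle a word of length [k] with a word of
   length [n - k] over a disjoint alphabet. *)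
Lemma sum_words_shuffle (p : pred T) s n (F G : seq T -> R) :
  \sum_(W <- words_over s n) F [seq x <- W | p x] * G [seq x <- W | predC p x] =
  \sum_(k < n.+1) 'C(n, k)%:R *
    ((\sum_(U <- words_over [seq x <- s | p x] k) F U) *
     (\sum_(V <- words_over [seq x <- s | predC p x] (n - k)) G V)).
Proof.
elim: n F G => [|n IHn] F G.
  by rewrite big_ord1 /= !big_seq1 mul1r.
(* The last letter belongs either to the first word or to the second. The induction hypothesis, with
   that letter absorbed into [F] or into [G], gives two sums that Pascal's rule recombines. *)
rewrite sum_words_recr (bigID p) /=.
have -> : \sum_(a <- s | p a) \sum_(W <- words_over s n)
    F [seq x <- rcons W a | p x] * G [seq x <- rcons W a | predC p x] =
  \sum_(k < n.+1) 'C(n, k)%:R *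
    ((\sum_(U <- words_over [seq x <- s | p x] k.+1) F U) *
     (\sum_(V <- words_over [seq x <- s | predC p x] (n - k)) G V)).
  under [RHS]eq_bigr => k _ do rewrite sum_words_recr big_filter mulr_suml mulr_sumr.
  rewrite [RHS]exchange_big /=; apply: eq_bigr => a pa.
  under eq_bigr => W _ do rewrite !filter_rcons /= pa /=.
  exact: (IHn (fun U => F (rcons U a))).
have -> : \sum_(a <- s | ~~ p a) \sum_(W <- words_over s n)
    F [seq x <- rcons W a | p x] * G [seq x <- rcons W a | predC p x] =
  \sum_(k < n.+1) 'C(n, k)%:R *
    ((\sum_(U <- words_over [seq x <- s | p x] k) F U) *
     (\sum_(V <- words_over [seq x <- s | predC p x] (n - k).+1) G V)).
  under [RHS]eq_bigr => k _ do rewrite sum_words_recr big_filter mulr_sumr mulr_sumr.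
  rewrite [RHS]exchange_big /=; apply: eq_bigr => a npa.
  under eq_bigr => W _ do rewrite !filter_rcons /= (negbTE npa) /=.
  exact: (IHn _ (fun V => G (rcons V a))).
set A := fun k => \sum_(U <- words_over [seq x <- s | p x] k) F U.
set B := fun k => \sum_(V <- words_over [seq x <- s | predC p x] k) G V.
rewrite -[RHS]/(\sum_(k < n.+2) 'C(n.+1, k)%:R * (A k * B (n.+1 - k)%N)).
rewrite -[LHS]/(\sum_(k < n.+1) 'C(n, k)%:R * (A k.+1 * B (n - k)%N) +
                \sum_(k < n.+1) 'C(n, k)%:R * (A k * B (n - k).+1)).
rewrite [RHS]big_ord_recl /= bin0 mul1r.
under [in RHS]eq_bigr => k _ do rewrite /bump leq0n add1n binS natrD mulrDl subSS.
rewrite big_split /= addrA [LHS]addrC; congr (_ + _).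
rewrite big_ord_recl /= bin0 mul1r !subn0; congr (_ + _).
rewrite [RHS]big_ord_recr /= bin_small // mul0r addr0.
by apply: eq_bigr => k _; rewrite /bump leq0n add1n subnSK.
Qed.

Lemma sum_words_map (f : T -> T) s n F :
  \sum_(W <- words_over (map f s) n) F W =
  \sum_(W <- words_over s n) F (map f W).
Proof.
elim: n F => [|n IHn] F; first by rewrite !big_seq1.
rewrite !sum_words_recr big_map; apply: eq_bigr => a _.
by rewrite IHn; apply: eq_bigr => W _; rewrite map_rcons.
Qed.

End Words.

(** * Finite differences and Abel's binomial identity *)

(** Composition with ['X + 1] preserves the size and the leading coefficient, so the top
    coefficients cancel. *)
Lemma size_diff_comp (R : idomainType) (p : {poly R}) :
  (size (p \Po ('X + 1) - p)%R <= (size p).-1)%N.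
Proof.
have [->|p0] := eqVneq p 0; first by rewrite comp_poly0 subr0 size_poly0.
have X1 : ('X + 1 : {poly R}) = 'X + 1%:P by [].
have s2 : size ('X + 1 : {poly R}) = 2 by rewrite X1 size_XaddC.
have sc : size (p \Po ('X + 1)) = size p by rewrite size_comp_poly2.
have lc : lead_coef (p \Po ('X + 1)) = lead_coef p.
  by rewrite lead_coef_comp ?s2 // X1 lead_coefXaddC expr1n mulr1.
apply/leq_sizeP => j; rewrite coefB => jp.
have sp : (0 < size p)%N by rewrite size_poly_gt0.
have [->|ne] := eqVneq j (size p).-1.
  by rewrite -[in X in _ - X]lead_coefE -lc lead_coefE sc subrr.
have jp' : (size p <= j)%N by lia.
by rewrite !nth_default ?sc ?subrr.
Qed.

(** The sum is the [n]-th finite difference of [p] at 0. Each difference lowers the degree, and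
    Pascal's rule writes the sum for [n + 1] as the sum for [n] applied to the difference of [p]. *)
Lemma sum_signed_binomial_eq0 (R : idomainType) n (p : {poly R}) :
  (size p <= n)%N ->
  \sum_(k < n.+1) (-1) ^+ (n - k) * 'C(n, k)%:R * p.[k%:R] = 0.
Proof.
elim: n p => [|n IHn] p sp.
  by move: sp; rewrite leqn0 size_poly_eq0 => /eqP ->; rewrite big1 // => k _; rewrite horner0 mulr0.
have dn : (size (p \Po ('X + 1) - p)%R <= n)%N.
  by apply: leq_trans (size_diff_comp p) _; lia.
rewrite -[RHS](IHn _ dn).
under [RHS]eq_bigr => k _ do
  rewrite hornerD hornerN horner_comp hornerD hornerX hornerC natr1 mulrBr.
rewrite big_split [LHS]big_ord_recl /= bin0 mulr1.
under [in LHS]eq_bigr => k _ do rewrite /bump /= add1n subSS binS natrD mulrDr mulrDl.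
rewrite big_split /= addrA [RHS]addrC; congr (_ + _).
rewrite sumrN big_ord_recr /= bin_small // mulr0 mul0r addr0 big_ord_recl /= bin0 subn0.
rewrite mulr1 opprD subn0 exprS mulN1r mulNr; congr (_ + _).
rewrite -sumrN; apply: eq_bigr => k _; rewrite /bump /= add1n.
by rewrite -[(n - k)%N](subnSK (ltn_ord k)) exprS mulN1r !mulNr.
Qed.

Lemma eq_poly_deriv (F : numDomainType) (p q : {poly F}) (x : F) :
  p^`() = q^`() -> p.[x] = q.[x] -> p = q.
Proof.
move=> dpq pqx; apply/subr0_eq; set d := p - q.
have d' : d^`() = 0 by rewrite derivB dpq subrr.
have dC : d = (d`_0)%:P.
  apply/polyP => -[|i]; first by rewrite coefC eqxx.
  have := congr1 (fun p : {poly F} => p`_i) d'.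
  rewrite coef_deriv coef0 coefC /= => /eqP.
  by rewrite mulrn_eq0 /= => /eqP.
have : d.[x] = 0 by rewrite hornerD hornerN pqx subrr.
by rewrite dC hornerC => ->; rewrite polyC0.
Qed.

(** Induction on [n] through derivatives: the derivative of either side for [n + 1] is [n + 1] times
    the same side for [n], composed with ['X + 1]. It remains to compare the two sides at one
    point. *)
Lemma Abel_binomial_poly (F : numDomainType) n :
  \sum_(k < n.+1) ('C(n, k) * k.+1 ^ k.-1)%:R *: ('X + (n - k)%:R%:P) ^+ (n - k) =
  ('X + n.+1%:R%:P) ^+ n :> {poly F}.
Proof.
elim: n => [|n IHn]; first by rewrite big_ord1 /= !expr0 scale1r.
have dX m (c : F) : (('X + c%:P) ^+ m)^`() = ('X + c%:P) ^+ m.-1 *+ m.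
  by rewrite deriv_exp derivD derivX derivC addr0 mul1r.
have sX m (c : F) : ('X + c%:P) ^+ m \Po ('X + 1%:P) = ('X + (c + 1)%:P) ^+ m.
  by rewrite rmorphXn /= comp_polyD comp_polyX comp_polyC -addrA -polyCD [1 + c]addrC.
(* At this point the right-hand side vanishes and ['X + (n + 1 - k)] becomes [- (k + 1)]. The powers
   of [k + 1] then combine into a power [n], and the left-hand side is a difference of order [n + 1]
   of a polynomial of degree [n]. *)
apply: (@eq_poly_deriv _ _ _ (- n.+2%:R)).
  rewrite raddf_sum big_ord_recr /= subnn expr0 linearZ /= derivC scaler0 addr0.
  rewrite [RHS]dX /= -natr1 -sX -IHn raddf_sum -sumrMnl.
  apply: eq_bigr => k _; rewrite /= derivZ comp_polyZ sX natr1 -subSn; last by rewrite -ltnS.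
  rewrite dX -scaler_nat -[in RHS]scaler_nat !scalerA -!natrM.
  congr (_%:R *: _ ^+ _); last by lia.
  (* This is [(n + 1) * 'C(n, k) = (n + 1 - k) * 'C(n + 1, k)]. *)
  by have := mul_bin_down n.+1 k; rewrite /=; nia.
have eX m (c x : F) : (('X + c%:P) ^+ m).[x] = (x + c) ^+ m.
  by rewrite horner_exp hornerD hornerX hornerC.
rewrite eX addNr expr0n horner_sum.
rewrite -[RHS](@sum_signed_binomial_eq0 _ n.+1 (('X + 1%:P) ^+ n)); last first.
  have := size_exp ('X + 1%:P : {poly F}) n; rewrite size_XaddC /= mul1n => E; exact: leq_trans (leqSpred _) (eq_leq (congr1 S E)).
apply: eq_bigr => k _; rewrite hornerZ !eX natr1.
have -> : - n.+2%:R + (n.+1 - k)%:R = - k.+1%:R :> F.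
  by rewrite natrB -1?ltnS // -[n.+2%:R]natr1 -[k.+1%:R]natr1; ring.
have -> : k.+1%:R ^+ n = (k.+1 ^ k.-1)%:R * k.+1%:R ^+ (n.+1 - k) :> F.
  rewrite natrX -exprD; have kn : (k <= n.+1)%N by rewrite -ltnS.
  (* For [k = 0] the predecessor in the exponent is truncated, but the base is 1. *)
  by case: (val k) kn => [|m] mn; rewrite ?expr1n //; congr (_ ^+ _); lia.
by rewrite natrM [in LHS]exprNn; ring.
Qed.

Lemma Abel_binomial (F : numDomainType) n :
  \sum_(k < n.+1) ('C(n, k) * k.+1 ^ k.-1 * (n - k).+1 ^ (n - k))%:R =
  (n.+2 ^ n)%:R :> F.
Proof.
have := congr1 (fun p : {poly F} => p.[1]) (Abel_binomial_poly F n).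
rewrite /= horner_sum horner_exp hornerD hornerX hornerC addrC natr1 -natrX => <-.
apply: eq_bigr => k _.
rewrite hornerZ horner_exp hornerD hornerX hornerC addrC natr1.
by rewrite natrM natrX.
Qed.

(** * Weighted sums of probabilities, and their splitting at a gap *)

Section TotalMass.
Variables (R : realType) (P : bilateral_procedure R).
Implicit Types (S : {fset int}) (W : word) (g : word -> {fset int} -> R).

Definition mass g S : R :=
  \sum_(W <- words_over (enum_fset S) #|` S|) prob P W S * g W S.

Lemma mass_translate g S (n : nat) : shift_invariant P ->
  (forall W S, is_vertex (W, S) ->
     g [seq x + n%:Z | x <- W] (translate_fset n%:Z S) = g W S) ->
  mass g (translate_fset n%:Z S) = mass g S.
Proof.
move=> inv ginv; rewrite /mass card_translate.
rewrite (sum_words_support (s' := [seq x + n%:Z | x <- enum_fset S])) ?fset_uniq //.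
- rewrite sum_words_map; apply: eq_bigr => W _; rewrite prob_translate //.
  have [->|/prob_vertex V] := eqVneq (prob P W S) 0; first by rewrite !mul0r.
  by rewrite ginv.
- by rewrite map_inj_uniq ?fset_uniq //; apply: addIr.
- by move=> _ /mapP[x xS ->]; rewrite mem_translate.
move=> W _ /eqP F0; have : prob P W (translate_fset n%:Z S) != 0.
  by apply/eqP => p0; apply: F0; rewrite p0 mul0r.
move=> /prob_vertex[_ /= sub] x /sub; rewrite mem_translateB => xS.
by apply/mapP; exists (x - n%:Z); rewrite ?subrK.
Qed.

Lemma card_fset_filter S (p : pred int) :
  #|` S| = (#|` [fset x in S | p x]%fset| + #|` [fset x in S | predC p x]%fset|)%N.
Proof.
have cardE q : #|` [fset x in S | q x]%fset| = count q (enum_fset S).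
  by rewrite -size_filter; apply/perm_size/perm_fset_filter.
by rewrite !cardE count_predC.
Qed.

(** In the shuffle formula a single [k] survives: [F] vanishes on every word whose length is not the
    number of spots of its region. *)
Lemma sum_words_vertex_shuffle (p : pred int) S (F G : word -> R) :
  (forall U, F U != 0 -> is_vertex (U, [fset x in S | p x]%fset)) ->
  (forall V, G V != 0 -> is_vertex (V, [fset x in S | predC p x]%fset)) ->
  \sum_(W <- words_over (enum_fset S) #|` S|)
     F [seq x <- W | p x] * G [seq x <- W | predC p x] =
  'C(#|` S|, #|` [fset x in S | p x]%fset|)%:R *
  ((\sum_(U <- words_over (enum_fset [fset x in S | p x]%fset)
                          #|` [fset x in S | p x]%fset|) F U) *
   (\sum_(V <- words_over (enum_fset [fset x in S | predC p x]%fset)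
                          #|` [fset x in S | predC p x]%fset|) G V)).
Proof.
have supp q (H : word -> R) n :
    (forall U, H U != 0 -> is_vertex (U, [fset x in S | q x]%fset)) ->
  \sum_(U <- words_over [seq x <- enum_fset S | q x] n) H U =
  \sum_(U <- words_over (enum_fset [fset x in S | q x]%fset) n) H U.
  move=> Hq; apply: sum_words_support; rewrite ?filter_uniq ?fset_uniq //.
    by move=> x; rewrite mem_filter !inE andbC.
  by move=> U _ /Hq[_ /= sub] x /sub.
move=> Fp Gp; rewrite sum_words_shuffle.
have cS := card_fset_filter S p.
have kS : (#|` [fset x in S | p x]%fset| < #|` S|.+1)%N by rewrite cS ltnS leq_addr.
rewrite (bigD1 (Ordinal kS)) //= [X in _ + X]big1 ?addr0 => [|k kne].
  have -> : (#|` S| - #|` [fset x in S | p x]%fset|)%N =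
      #|` [fset x in S | predC p x]%fset| by rewrite cS addKn.
  by rewrite !supp.
rewrite [X in _ * (X * _)]big1_seq ?mul0r ?mulr0 // => U /andP[_].
rewrite mem_words_over => /andP[/eqP Uk _]; apply/eqP; apply: contraNT kne.
by move=> /Fp[/= cU _]; apply/eqP/val_inj; rewrite /= cU Uk.
Qed.

Definition spots (n : nat) : {fset int} := [fset Posz i | i in iota 1 n]%fset.

Lemma mem_spots n x : (x \in spots n) = (1 <= x <= n%:Z).
Proof.
apply/imfsetP/idP => /= [[i + ->]|xn]; first by rewrite mem_iota; lia.
by exists (absz x); rewrite ?mem_iota; lia.
Qed.

Lemma card_spots n : #|` spots n| = n.
Proof. by rewrite card_in_imfset /= ?undup_id ?iota_uniq ?size_iota // => i k _ _ []. Qed.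

Definition one_weight W S : R := 1.
Definition right_weight W S : R := \sum_(a <- enum_fset S) Dir P W S a.

Lemma right_weight_translate W S (n : nat) : shift_invariant P -> is_vertex (W, S) ->
  right_weight [seq x + n%:Z | x <- W] (translate_fset n%:Z S) = right_weight W S.
Proof.
move=> inv V; rewrite /right_weight (perm_big _ (perm_translate n%:Z S)) big_map.
by rewrite big_seq [RHS]big_seq; apply: eq_bigr => a aS; rewrite Dir_translate.
Qed.

(** The preference [j] contributes 1, a preference on the left the probability to go right, and one
    on the right the probability to go left. By [Dir_filter] each of these depends only on the cars
    of its own side. *)
Lemma sum_hop_gap W S (j : int) : locally_decided P -> j \notin S ->
  0 < prob P W S ->
  let p := fun x => x < j in
  let q := predC p in
  0 < prob P [seq x <- W | p x] [fset x in S | p x]%fset ->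
  0 < prob P [seq x <- W | q x] [fset x in S | q x]%fset ->
  \sum_(a <- j :: enum_fset S) hop P W S a j =
  1 + right_weight [seq x <- W | p x] [fset x in S | p x]%fset +
  (#|` [fset x in S | q x]%fset|%:R -
   right_weight [seq x <- W | q x] [fset x in S | q x]%fset).
Proof.
move=> loc jS W0 p q p0 q0.
have sp : separated p S := separated_gap jS.
have sumE r (F : int -> R) :
    \sum_(a <- enum_fset [fset x in S | r x]%fset) F a = \sum_(a <- enum_fset S | r a) F a.
  by rewrite -[RHS]big_filter; apply/perm_big/perm_fset_filter.
rewrite big_cons {1}/hop eqxx -addrA; congr (_ + _).
rewrite (bigID p) /=; congr (_ + _).
  rewrite /right_weight sumE big_seq_cond [RHS]big_seq_cond.
  apply: eq_bigr => a /andP[aS pa]; rewrite -(Dir_filter loc sp aS pa W0 p0).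
  by rewrite /hop (lt_eqF pa) (pa : a < j).
rewrite -sum1_size natr_sum /right_weight !sumE -sumrB.
rewrite big_seq_cond [RHS]big_seq_cond.
apply: eq_bigr => a /andP[aS qa]; rewrite /hop (negbTE (qa : ~~ (a < j))).
rewrite -(Dir_filter loc (separatedC sp) aS qa W0 q0).
by case: eqVneq => // aj; rewrite -aj aS in jS.
Qed.

(** By independence and [sum_hop_gap], the summand is a combination of three products of a function
    of the left cars by a function of the right cars. Each of them is summed by shuffling. *)
Lemma sum_gap S (j : int) : locally_decided P -> j \notin S ->
  let S1 := [fset x in S | x < j]%fset in
  let S2 := [fset x in S | ~~ (x < j)]%fset in
  \sum_(W <- words_over (enum_fset S) #|` S|)
     prob P W S * (\sum_(a <- j :: enum_fset S) hop P W S a j) =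
  'C(#|` S|, #|` S1|)%:R *
  ((#|` S2|.+1)%:R * (mass one_weight S1 * mass one_weight S2) +
   (mass right_weight S1 * mass one_weight S2 -
    mass one_weight S1 * mass right_weight S2)).
Proof.
move=> loc jS S1 S2.
pose p := fun x : int => x < j.
pose F g U := prob P U S1 * g U S1.
pose G g V := prob P V S2 * g V S2.
have sp : separated p S := separated_gap jS.
have shuffle g h : \sum_(W <- words_over (enum_fset S) #|` S|)
    F g [seq x <- W | p x] * G h [seq x <- W | predC p x] =
    'C(#|` S|, #|` S1|)%:R * (mass g S1 * mass h S2).
  rewrite sum_words_vertex_shuffle // => U; rewrite mulf_eq0 negb_or => /andP[+ _];
  exact: prob_vertex.
rewrite mulrDr mulrBr mulrCA -!shuffle mulr_sumr -sumrB -big_split /=.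
apply: eq_bigr => W _; rewrite /F /G /one_weight !mulr1.
have gt0 V T : prob P V T != 0 -> 0 < prob P V T.
  by rewrite lt_neqAle eq_sym prob_ge0 => ->.
have WE := prob_separated W loc sp.
(* [sum_hop_gap] requires positive probabilities. When the product is zero, one of its factors is,
   and every term vanishes. *)
have [W0|W0] := eqVneq (prob P W S) 0.
  move: WE; rewrite W0 mul0r -/S1 => /esym/eqP.
  rewrite mulf_eq0 => /orP[] /eqP E.
    by rewrite [prob P [seq x <- W | p x] S1]E !mul0r mulr0 subrr addr0.
  by rewrite [prob P [seq x <- W | predC p x] S2]E !(mul0r, mulr0) subrr addr0.
have := W0; rewrite WE mulf_eq0 negb_or => /andP[/gt0 p0 /gt0 q0].
rewrite (sum_hop_gap loc jS (gt0 _ _ W0) p0 q0) -natr1.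
have distr (x y c u v : R) :
  x * y * (1 + u + (c - v)) = (c + 1) * (x * y) + (x * u * y - x * (y * v)) by ring.
exact: distr.
Qed.

End TotalMass.

(** * The recursion for intervals and its solution *)

Local Notation a_ P n := (mass P (@one_weight _) (spots n)).
Local Notation b_ P n := (mass P (right_weight P) (spots n)).

Lemma reach_spots n a j : a \in spots n -> j \in spots n ->
  reach (spots n `\ j)%fset a j.
Proof.
rewrite !mem_spots => an jn; apply/asboolP => z zj zaj.
by rewrite !inE zj mem_spots; lia.
Qed.

(** The sum is rearranged according to the spot [j] taken by the last car. With all other spots of
    the interval full, [j] is reachable from every preference. *)
Lemma mass_spots_last_car (R : realType) (P : bilateral_procedure R) n :
 
  a_ P n.+1 = \sum_(j <- enum_fset (spots n.+1))
    let S := (spots n.+1 `\ j)%fset in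
    \sum_(W <- words_over (enum_fset S) #|` S|)
       prob P W S * \sum_(a <- j :: enum_fset S) hop P W S a j.
Proof.
rewrite /mass card_spots sum_words_recr.
transitivity (\sum_(a <- enum_fset (spots n.+1))
  \sum_(W <- words_over (enum_fset (spots n.+1)) n)
  \sum_(j <- enum_fset (spots n.+1))
     prob P W (spots n.+1 `\ j)%fset * hop P W (spots n.+1 `\ j)%fset a j).
  rewrite big_seq [RHS]big_seq; apply: eq_bigr => a aI; apply: eq_bigr => W _.
  rewrite mulr1 prob_rcons big_seq_cond [RHS]big_seq; apply: eq_bigl => j.
  by apply: andb_idr => jI; apply: reach_spots.
under eq_bigr do rewrite exchange_big /=.
rewrite exchange_big /= big_seq [RHS]big_seq; apply: eq_bigr => j jI.
have cS : #|` (spots n.+1 `\ j)%fset| = n.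
  by have := cardfsD1 j (spots n.+1); rewrite card_spots jI => -[].
(* A word using the letter [j] cannot lead to a state where [j] is free, so the alphabet shrinks to
   the other spots. *)
rewrite exchange_big cS (sum_words_support (s' := enum_fset (spots n.+1 `\ j)%fset)) ?fset_uniq //.
- apply: eq_bigr => W _; rewrite -mulr_sumr; congr (_ * _); apply: perm_big.
  apply: uniq_perm; rewrite /= ?fset_uniq ?inE ?eqxx //= => x.
  by rewrite !inE; case: eqVneq => // ->.
- by move=> x; rewrite !inE => /andP[].
move=> W _; rewrite -mulr_sumr mulf_eq0 negb_or => /andP[/prob_vertex[_ /= sub] _].
by move=> x /sub.
Qed.

Lemma mass_spots_rec (R : realType) (P : bilateral_procedure R) n : is_local P ->
 
  a_ P n.+1 = \sum_(k < n.+1) 'C(n, k)%:R *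
    ((n - k).+1%:R * (a_ P k * a_ P (n - k)) + (b_ P k * a_ P (n - k) - a_ P k * b_ P (n - k))).
Proof.
move=> [inv loc].
rewrite mass_spots_last_car (perm_big [seq Posz i | i <- iota 1 n.+1]); last first.
  apply: uniq_perm; rewrite ?fset_uniq ?map_inj_uniq ?iota_uniq //; first by move=> i k [].
  move=> x; apply/idP/mapP => [|[i]].
    by rewrite mem_spots => xn; exists (absz x); rewrite ?mem_iota; lia.
  by rewrite mem_iota => i_n ->; rewrite mem_spots; lia.
rewrite big_map -[1%N]/(1 + 0)%N iotaDl big_map -[iota 0 _]/(index_iota 0 n.+1) big_mkord.
apply: eq_bigr => k _; rewrite /= add1n.
have kn : (k <= n)%N by rewrite -ltnS.
set S := (_ `\ _)%fset.
have cS : #|` S| = n.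
  have kI : Posz k.+1 \in spots n.+1 by rewrite mem_spots; lia.
  by have := cardfsD1 (Posz k.+1) (spots n.+1); rewrite card_spots kI => -[].
have jS : Posz k.+1 \notin S by rewrite !inE eqxx.
rewrite (sum_gap loc jS).
have -> : [fset x in S | x < k.+1%:Z]%fset = spots k.
  by apply/fsetP => x; rewrite !inE !mem_spots; lia.
(* The spots on the right of the gap run from [k + 2] to [n + 1]. *)
have -> : [fset x in S | ~~ (x < k.+1%:Z)]%fset = translate_fset k.+1%:Z (spots (n - k)).
  by apply/fsetP => x; rewrite mem_translateB !inE !mem_spots; lia.
rewrite cS card_translate !card_spots !mass_translate // => W T V.
exact: right_weight_translate.
Qed.

Lemma mass_spots (R : realType) (P : bilateral_procedure R) n : is_local P ->
  a_ P n = (n.+1 ^ n.-1)%:R.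
Proof.
move=> hP; elim/ltn_ind: n => -[|n] IHn.
  by rewrite /mass card_spots big_seq1 prob_nil /one_weight mulr1 -cardfs_eq0 card_spots.
rewrite mass_spots_rec // -Abel_binomial.
under eq_bigr => k _ do rewrite mulrDr mulrBr.
rewrite big_split /= sumrB.
have -> : \sum_(k < n.+1) 'C(n, k)%:R * (b_ P k * a_ P (n - k)) =
          \sum_(k < n.+1) 'C(n, k)%:R * (a_ P k * b_ P (n - k)) :> R.
  rewrite (reindex_inj rev_ord_inj) /=; apply: eq_bigr => k _.
  have kn : (k <= n)%N by rewrite -ltnS.
  by rewrite subSS bin_sub // subKn // [a_ P _ * b_ P _]mulrC.
rewrite subrr addr0; apply: eq_bigr => k _.
have kn : (k <= n)%N by rewrite -ltnS.
rewrite !IHn ?ltnS ?leq_subr // !natrM -!mulrA; congr (_ * _).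
rewrite mulrCA; congr (_ * _); rewrite -natrM -expnS.
(* The factor [l + 1] raises the exponent [l - 1] to [l]; for [l = 0] the truncated exponent is
   harmless, the base being 1. *)
by case: (n - k)%N => [|m] //; rewrite exp1n.
Qed.

Theorem theorem4p2 (R : realType) (P : bilateral_procedure R) (hP : is_local P)
    (r : nat) (hr : (1 <= r)%N) :
  (\esum_(W in [set W : word | size W = r]) (park P W)%:E
   = (((r + 1) ^ (r - 1))%N%:R)%:E)%E.
Proof.
(* A nonzero parking probability forces a vertex, hence all letters in [spots r]. The sum over
   infinitely many words thus reduces to a finite one. *)
rewrite (esumID [set W : word | {subset W <= spots r}]) => [|W _]; last by rewrite lee_fin prob_ge0.
rewrite [X in (_ + X)%E]esum1 ?adde0 => [|W [/= Wr Wsub]]; last first.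
  congr (_%:E); apply/eqP; apply: contra_notT Wsub => /prob_vertex[_ /= +] x xW.
  by rewrite -/(spots _) Wr => /(_ x xW).
have -> : [set W : word | size W = r] `&` [set W : word | {subset W <= spots r}] =
          [set` words_over (enum_fset (spots r)) r].
  apply/seteqP; split=> W /=; rewrite mem_words_over.
    by case=> -> Wsub; rewrite eqxx; apply/allP => x /Wsub.
  by case/andP => /eqP -> /allP.
rewrite esum_fset; [|exact: finite_seq|by move=> W _; rewrite lee_fin prob_ge0].
rewrite -fsbig_seq ?uniq_words_over ?fset_uniq // sumEFin; congr (_%:E).
rewrite addn1 subn1 -(mass_spots _ hP) /mass card_spots big_seq [RHS]big_seq.
apply: eq_bigr => W; rewrite mem_words_over => /andP[/eqP Wr _].
by rewrite /park Wr mulr1.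
Qed.
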